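(* Let $\mathcal K$ be a relational Fraïssé class with companion $\mathcal K^*$, and assume $G_\mathcal K$ is oligomorphic. Then the following are equivalent: (1) $|G_\mathcal K:G_{\mathcal K^*}|$ is finite; (2) $|G_\mathcal K:G_{\mathcal K^*}|=2^m$ for some $m\in\mathbb N$; (3) $M(G_\mathcal K)$ is finite; (4) $|M(G_\mathcal K)|=2^m$ for some $m\in\mathbb N$; (5) $G_{\mathcal K^*}$ is a normal subgroup of $G_\mathcal K$.
   Context: Structures are over a countable relational language $L$. A Fraïssé class is a class of finite structures that is hereditary, has joint embedding and amalgamation, and contains arbitrarily large finite structures; $\mathrm{Flim}$ denotes the Fraïssé limit, $G_\mathcal K=\mathrm{Aut}(\mathrm{Flim}(\mathcal K))$ with the pointwise convergence topology, and $M(G)$ the universal minimal $G$-flow (flows: continuous actions on compact Hausdorff spaces). An ordered class $\mathcal K^*$ consists of structures $(A,<^A)$, $<^A$ a linear order on an $L$-structure $A$ (called $\mathcal K^*$-admissible); its $L$-reduct is $\{A:(A,<^A)\in\mathcal K^*\}$. $\mathcal K^*$ is reasonable if for all $A,B$ in the reduct, every embedding $a:A\to B$ and admissible $<^A$ on $A$ there is an admissible $<^B$ on $B$ with $a$ an embedding $(A,<^A)\to(B,<^B)$. $\mathcal K^*$ has the ordering property if for every $A$ in the reduct there is $B$ in the reduct with $(A,<^A)$ embeddable in $(B,<^B)$ for all admissible $<^A,<^B$. A class is Ramsey if for all $A,B$ in it and $k\ge2$ there is $C$ in it such that every colouring of the substructures of $C$ isomorphic to $A$ with $k$ colours is constant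 on the copies of $A$ inside some substructure of $C$ isomorphic to $B$. A companion of $\mathcal K$ is a reasonable ordered Fraïssé class $\mathcal K^*$ in $L\cup\{<\}$ which is Ramsey, has the ordering property, and has $L$-reduct $\mathcal K$. For reasonable $\mathcal K^*$, $\mathrm{Flim}(\mathcal K^* )=(\mathrm{Flim}(\mathcal K),<^* )$ for a linear order $<^*$, and $G_{\mathcal K^*}$ is identified with the subgroup of $G_\mathcal K$ preserving $<^*$. A permutation group on $F$ is oligomorphic if for each $n$ its diagonal action on $F^n$ has finitely many orbits. *)

(* Defs.v *)
From HB Require Import structures.
From mathcomp Require Import all_boot all_order.
From mathcomp Require Import all_classical topology.
Unset Implicit Arguments. Unset Strict Implicit. Unset Printing Implicit Defensive.
Local Open Scope classical_set_scope.

Definition interp {sym : Type} (ar : sym -> nat) (A : Type) :=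
  forall R : sym, ('I_(ar R) -> A) -> Prop.

(* Finite structures; every finite structure is (up to iso) on some 'I_n. *)
Record fstruc {sym : Type} (ar : sym -> nat) := FStruc {
  fsz : nat;
  frel : interp ar 'I_fsz }.
Arguments FStruc {sym ar}.
Arguments fsz {sym ar}.
Arguments frel {sym ar}.

Section Structures.
Context {sym : Type} {ar : sym -> nat}.
Local Notation fS := (fstruc ar).

Definition emb (A B : fS) (f : 'I_(fsz A) -> 'I_(fsz B)) : Prop :=
  injective f /\ forall R (x : 'I_(ar R) -> 'I_(fsz A)), frel A R x <-> frel B R (f \o x).

Definition embeds (A B : fS) : Prop := exists f, emb A B f.

Definition isomorphic (A B : fS) : Prop := exists f, emb A B f /\ bijective f.

(* Fraisse class (a class of finite structures is implicitly closed under iso). *)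
Definition iso_closed (K : fS -> Prop) := forall A B, isomorphic A B -> K A -> K B.
Definition hereditary (K : fS -> Prop) := forall A B, K B -> embeds A B -> K A.
Definition JEP (K : fS -> Prop) :=
  forall A B, K A -> K B -> exists C, K C /\ embeds A C /\ embeds B C.
Definition AP (K : fS -> Prop) :=
  forall (A B C : fS) f g, K A -> K B -> K C -> emb A B f -> emb A C g ->
  exists (D : fS) h k, K D /\ emb B D h /\ emb C D k /\ h \o f = k \o g.
Definition arbitrarily_large (K : fS -> Prop) :=
  forall n, exists A, K A /\ n <= fsz A.
Definition fraisse_class (K : fS -> Prop) :=
  [/\ iso_closed K, hereditary K, JEP K, AP K & arbitrarily_large K].

Definition is_copy (A C : fS) (S : {set 'I_(fsz C)}) :=
  exists f, emb A C f /\ S = (f @: [set: 'I_(fsz A)])%SET.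

Definition ramsey (K : fS -> Prop) :=
  forall (A B : fS) (k : nat), K A -> K B -> 2 <= k ->
  exists C : fS, K C /\
    forall c : {set 'I_(fsz C)} -> 'I_k,
    exists g, emb B C g /\ exists i : 'I_k,
      forall S, is_copy A C S -> S \subset (g @: [set: 'I_(fsz B)])%SET -> c S = i.

Definition embF {T : Type} (A : fS) (I : interp ar T) (e : 'I_(fsz A) -> T) :=
  injective e /\ forall R (x : 'I_(ar R) -> 'I_(fsz A)), frel A R x <-> I R (e \o x).

Definition aut {T : Type} (I : interp ar T) (g : T -> T) : Prop :=
  bijective g /\ forall R (x : 'I_(ar R) -> T), I R x <-> I R (g \o x).

(* (T, I) is the Fraisse limit of K: a countable (T is a countType)
   ultrahomogeneous structure whose age is K. *)
Definition is_flim (K : fS -> Prop) {T : Type} (I : interp ar T) :=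
  (forall A, K A <-> exists e, embF A I e) /\
  (forall A e1 e2, embF A I e1 -> embF A I e2 ->
      exists g, aut I g /\ g \o e1 = e2).
End Structures.

Definition oar {sym : Type} (ar : sym -> nat) (o : option sym) : nat :=
  match o with Some R => ar R | None => 2 end.

Definition pair2 {A : Type} (a b : A) : 'I_2 -> A :=
  fun i => if val i == 0 then a else b.

Definition ltS {sym : Type} {ar : sym -> nat} (B : fstruc (oar ar)) (a b : 'I_(fsz B)) :=
  frel B None (pair2 a b).

Definition strict_linear_order {A : Type} (lt : A -> A -> Prop) :=
  (forall a, ~ lt a a) /\ (forall a b c, lt a b -> lt b c -> lt a c) /\
  (forall a b, a <> b -> lt a b \/ lt b a).

Definition expandI {sym : Type} {ar : sym -> nat} {A : Type} (I : interp ar A)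
  (lt : A -> A -> Prop) : interp (oar ar) A :=
  fun o => match o return ('I_(oar ar o) -> A) -> Prop with
           | Some R => I R
           | None => fun x => lt (x (@ord0 1)) (x (@ord_max 1))
           end.

Definition expand {sym : Type} {ar : sym -> nat} (A : fstruc ar)
  (lt : 'I_(fsz A) -> 'I_(fsz A) -> Prop) : fstruc (oar ar) :=
  @FStruc _ (oar ar) (fsz A) (expandI (frel A) lt).

Section Companion.
Context {sym : Type} {ar : sym -> nat}.
Variables (K : fstruc ar -> Prop) (Kstar : fstruc (oar ar) -> Prop).

Definition ordered_class := forall B, Kstar B -> strict_linear_order (ltS B).

Definition admissible (A : fstruc ar) (lt : 'I_(fsz A) -> 'I_(fsz A) -> Prop) :=
  Kstar (expand A lt).

Definition reduct_is := forall A, K A <-> exists lt, admissible A lt.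

Definition reasonable :=
  forall (A B : fstruc ar) (a : 'I_(fsz A) -> 'I_(fsz B)) ltA,
  K A -> K B -> emb A B a -> admissible A ltA ->
  exists ltB, admissible B ltB /\ emb (expand A ltA) (expand B ltB) a.

Definition ordering_property :=
  forall A, K A -> exists B, K B /\
    forall ltA ltB, admissible A ltA -> admissible B ltB ->
      embeds (expand A ltA) (expand B ltB).

Definition companion :=
  ordered_class /\ reasonable /\ fraisse_class Kstar /\ ramsey Kstar /\
  ordering_property /\ reduct_is.
End Companion.

Section Groups.
Context {T : Type}.
Implicit Types G H : (T -> T) -> Prop.

Definition oligomorphic G :=
  forall n, exists k (u : 'I_k -> ('I_n -> T)),
    forall x : 'I_n -> T, exists i g, G g /\ g \o u i = x.

Definition index_eq G H (n : nat) :=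
  exists r : 'I_n -> (T -> T),
    (forall i, G (r i)) /\
    (forall g, G g -> exists i h, H h /\ g = r i \o h) /\
    (forall i j h, H h -> r i = r j \o h -> i = j).

Definition finite_index G H := exists n, index_eq G H n.

Definition normal_sub G H :=
  forall g ginv h, G g -> cancel g ginv -> cancel ginv g -> H h ->
    H (g \o h \o ginv).
End Groups.

Section Flows.
Context {T : eqType}.
Variable (G : (T -> T) -> Prop).

(* continuous action on a compact Hausdorff space; basic neighbourhoods of g
   in the pointwise-convergence topology are {h | h = g on a finite A}. *)
Definition is_flow (X : topologicalType) (act : (T -> T) -> X -> X) :=
  [/\ compact [set: X], hausdorff_space X,
      (forall x, act id x = x),
      (forall g h x, G g -> G h -> act (g \o h) x = act g (act h x)) &
      (forall g x (U : set X), G g -> nbhs (act g x) U ->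
         exists (A : seq T) (V : set X), nbhs x V /\
           forall h y, G h -> V y -> (forall a, a \in A -> h a = g a) ->
             U (act h y))].

Definition minimal_flow (X : topologicalType) (act : (T -> T) -> X -> X) :=
  [/\ is_flow X act, [set: X] !=set0 &
      forall Y : set X, closed Y -> Y !=set0 ->
        (forall g x, G g -> Y x -> Y (act g x)) -> Y = [set: X]].

Definition flow_hom (X Y : topologicalType) (actX : (T -> T) -> X -> X)
  (actY : (T -> T) -> Y -> Y) (phi : X -> Y) :=
  continuous phi /\ forall g x, G g -> phi (actX g x) = actY g (phi x).

Definition universal_minimal_flow (X : topologicalType) (act : (T -> T) -> X -> X) :=
  minimal_flow X act /\
  forall (Y : topologicalType) (actY : (T -> T) -> Y -> Y), minimal_flow Y actY ->
    exists phi : X -> Y, flow_hom X Y act actY phi /\ forall y, exists x, phi x = y.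

(* |M(G)| = n (M(G) is unique up to isomorphism) *)
Definition UMF_card (n : nat) :=
  exists (X : topologicalType) (act : (T -> T) -> X -> X),
    universal_minimal_flow X act /\ exists f : X -> 'I_n, bijective f.

Definition UMF_finite := exists n, UMF_card n.
End Flows.

(* Main.v *)
From HB Require Import structures.
From mathcomp Require Import all_boot all_fingroup all_algebra.
From mathcomp Require Import all_classical topology.
Require Import Defs.

(** Write G for the automorphism group of the limit and H for the stabilizer of
    the generic order.  By the Ramsey property of the companion, H has a fixed
    point in every nonempty closed H-invariant subset of a flow; by the
    ordering property, the compact space of admissible orders on the limit is a
    minimal G-flow in which the orbit of the generic order is a dense copy of
    G/H.

    If the index is finite, every H-orbit in G/H is finite, hence closed, hence
    a single point, so H is normal; moreover G/H is the whole order space, and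
    sending the generic order to an H-fixed point of a minimal flow Y defines a
    map onto Y, so that M(G) has |G:H| points.  Conversely a finite M(G) maps
    onto the order space and bounds the index.

    If H is normal, every g in G either preserves or reverses the generic order
    on all the pairs of a given G-orbit.  By oligomorphy there are finitely
    many such orbits, and recording these signs embeds G/H in a power of Z/2. *)

Set Implicit Arguments.
Unset Strict Implicit.
Unset Printing Implicit Defensive.

Local Open Scope classical_set_scope.

(** * Embeddings of finite structures and their induced substructures *)

Section Embeddings.
Context {sym : Type} {ar : sym -> nat} {T : Type}.
Implicit Types (A B : fstruc ar) (I : interp ar T).

Lemma embF_comp A B I f e : emb A B f -> embF B I e -> embF A I (e \o f).
Proof.
move=> [injf fP] [inje eP]; split; first exact: inj_comp.
by move=> R x; rewrite fP eP.
Qed.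

Lemma embF_aut A I e g : embF A I e -> aut I g -> embF A I (g \o e).
Proof.
move=> [inje eP] [bijg gP]; split; first exact: inj_comp (bij_inj bijg) inje.
by move=> R x; rewrite eP gP.
Qed.

Lemma embF_factor A B I e eB : embF A I e -> embF B I eB ->
  (forall a, exists b, eB b = e a) -> exists f, emb A B f /\ eB \o f = e.
Proof.
move=> [inje eP] [injB BP] /choice[f fP].
have ef : eB \o f = e by apply/funext.
exists f; split=> //; split; first by apply: (@inj_compr _ _ _ eB); rewrite ef.
by move=> R x; rewrite BP eP -ef.
Qed.

Definition induced I n (e : 'I_n -> T) : fstruc ar :=
  FStruc n (fun R x => I R (e \o x)).

Lemma induced_embF I n (e : 'I_n -> T) :
  injective e -> embF (induced I e) I e.
Proof. by []. Qed.

End Embeddings.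

(** Removing duplicates makes the enumeration injective, so any finite list of points spans a finite
    structure [induced I (seq_enum s)]. *)
Definition seq_enum (T : eqType) (s : seq T) : 'I_(size (undup s)) -> T :=
  tnth (in_tuple (undup s)).
Arguments seq_enum {T} s.

Section SeqEnum.
Context {T : eqType}.
Implicit Type s : seq T.

Lemma seq_enum_inj s : injective (seq_enum s).
Proof. exact/tuple_uniqP/undup_uniq. Qed.

Lemma seq_enumP s x : x \in s -> exists i, seq_enum s i = x.
Proof. by rewrite -mem_undup => /(tnthP (in_tuple _))[i ->]; exists i. Qed.

Lemma mem_seq_enum s i : seq_enum s i \in s.
Proof. by rewrite -mem_undup; exact: (mem_tnth i (in_tuple _)). Qed.

End SeqEnum.

(** * The automorphism group *)

Section AutGroup.
Context {sym : Type} {ar : sym -> nat} {T : choiceType} (I : interp ar T).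
Implicit Types g h : T -> T.

(** [bijective g] only asserts that an inverse exists; choosing preimages yields one as a function
    of [g] alone. *)
Definition invf g (x : T) : T := xget x [set y | g y = x].

Lemma invfK g : bijective g -> cancel (invf g) g.
Proof.
move=> [k gk kg] x; have [_ ->//|/(_ (k x))] := xgetP x [set y | g y = x].
by rewrite /= kg.
Qed.

Lemma invfKV g : bijective g -> cancel g (invf g).
Proof. by move=> bijg x; apply: (bij_inj bijg); rewrite invfK. Qed.

Lemma invf_unique g k : cancel g k -> cancel k g -> invf g = k.
Proof.
move=> gk kg; have bijg : bijective g by exists k.
by apply/funext => x; apply: (bij_inj bijg); rewrite invfK.
Qed.

Lemma aut_bij g : aut I g -> bijective g. Proof. by case. Qed.

Lemma aut_id : aut I id.
Proof. by split => //; exists id. Qed.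

Lemma aut_comp g h : aut I g -> aut I h -> aut I (g \o h).
Proof.
move=> [bg gP] [bh hP]; split; first exact: bij_comp.
by move=> R x; rewrite hP gP.
Qed.

Lemma aut_inv g : aut I g -> aut I (invf g).
Proof.
move=> [bg gP]; split; first by exists g; [exact: invfK|exact: invfKV].
move=> R x; rewrite (gP R (invf g \o x)).
suff -> : g \o (invf g \o x) = x by [].
by apply/funext => i /=; rewrite invfK.
Qed.

Lemma comp_invf g : aut I g -> g \o invf g = id.
Proof. by move=> /aut_bij bg; apply/funext => x /=; rewrite invfK. Qed.

Lemma invf_comp g : aut I g -> invf g \o g = id.
Proof. by move=> /aut_bij bg; apply/funext => x /=; rewrite invfKV. Qed.

End AutGroup.

(** * Rigidity of finite orders and the Ramsey property in the limit *)

Lemma monotone_image_inj n m (ltA : 'I_n -> 'I_n -> Prop)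
    (ltC : 'I_m -> 'I_m -> Prop) (f1 f2 : 'I_n -> 'I_m) :
  strict_linear_order ltC -> injective f1 -> injective f2 ->
  (forall a b, ltA a b <-> ltC (f1 a) (f1 b)) ->
  (forall a b, ltA a b <-> ltC (f2 a) (f2 b)) ->
  (f1 @: [set: 'I_n] = f2 @: [set: 'I_n])%SET -> f1 = f2.
Proof.
move=> [irr [trans tot]] inj1 inj2 m1 m2 im12.
pose S := (f1 @: [set: 'I_n])%SET.
(* Both maps send [a] to the element of the common image having its rank. *)
pose d y := #|[set z in S | `[< ltC z y >]]%SET|.
have dE (f : 'I_n -> 'I_m) : injective f ->
    (forall a b, ltA a b <-> ltC (f a) (f b)) ->
    (S = f @: [set: 'I_n])%SET ->
    forall a, d (f a) = #|[set x | `[< ltA x a >]]%SET|.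
  move=> injf mf Sf a; rewrite /d -(card_imset _ injf); apply: eq_card => z.
  rewrite inE Sf; apply/andP/imsetP => [[/imsetP[x _ ->] /asboolP zx]|[x]].
    by exists x => //; rewrite inE; apply/asboolP/mf.
  by rewrite inE => /asboolP xa ->; split; [exact: imset_f|exact/asboolP/mf].
have dlt y y' : y \in S -> ltC y y' -> d y < d y'.
  move=> yS yy'; apply/proper_card/properP; split.
    apply/fintype.subsetP => z; rewrite !inE => /andP[-> /asboolP zy].
    by apply/asboolP; exact: trans zy yy'.
  exists y; rewrite !inE ?yS/=; first exact/asboolP.
  by apply/negP => /asboolP/irr.
have d12 a : d (f1 a) = d (f2 a) by rewrite (dE f1)// (dE f2).
apply/funext => a; apply/eqP; apply: contraT => /eqP/tot[] lt12.
- have f1S : f1 a \in S by rewrite imset_f.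
  by have := dlt _ _ f1S lt12; rewrite d12 ltnn.
- have f2S : f2 a \in S by rewrite /S im12 imset_f.
  by have := dlt _ _ f2S lt12; rewrite d12 ltnn.
Qed.

Lemma pair2_comp (A B : Type) (f : A -> B) a b :
  f \o pair2 a b = pair2 (f a) (f b).
Proof. by apply/funext => i; rewrite /pair2/=; case: ifP. Qed.

Section RamseyLimit.
Context {sym : Type} {ar : sym -> nat} {T : choiceType}.
Variables (Kstar : fstruc (oar ar) -> Prop) (J : interp (oar ar) T).
Hypotheses (ordK : ordered_class Kstar) (ramK : ramsey Kstar)
  (limK : is_flim Kstar J).

Lemma emb_copy_inj A C f1 f2 : Kstar C -> emb A C f1 -> emb A C f2 ->
  (f1 @: [set: 'I_(fsz A)] = f2 @: [set: 'I_(fsz A)])%SET -> f1 = f2.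
Proof.
move=> KC [inj1 m1] [inj2 m2].
apply: (@monotone_image_inj _ _ (ltS A) (ltS C)) => //; first exact: ordK.
- by move=> a b; rewrite /ltS m1 pair2_comp.
- by move=> a b; rewrite /ltS m2 pair2_comp.
Qed.

(* Members of [Kstar] are rigid, so a colouring of the embeddings of [A] into
   the limit is a colouring of the copies of [A]. *)
Lemma ramsey_flim A B k (eB : 'I_(fsz B) -> T)
    (col : ('I_(fsz A) -> T) -> 'I_k) :
  Kstar A -> embF B J eB -> 2 <= k ->
  exists p, aut J p /\
    exists i, forall f, emb A B f -> col (p \o eB \o f) = i.
Proof.
move=> KA eBP k2; have KB : Kstar B by apply/limK.1; exists eB.
have [C [KC Cram]] := ramK KA KB k2.
have [eC eCP] := (limK.1 C).1 KC.
pose i0 := Ordinal (ltnW k2).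
(* A copy gets the colour of the only embedding with that image; other sets get the default [i0]. *)
have /choice[c cP] (S : {set 'I_(fsz C)}) : exists i : 'I_k,
    forall f, emb A C f -> S = (f @: [set: 'I_(fsz A)])%SET -> col (eC \o f) = i.
  have [[f [embf ->]]|nf] := pselect (is_copy A C S).
    by exists (col (eC \o f)) => f' embf' /(emb_copy_inj KC embf embf') ->.
  by exists i0 => f embf Sf; case: nf; exists f.
have [g [embg [i iP]]] := Cram c.
(* Homogeneity carries the given copy of [B] onto the monochromatic one inside [C]. *)
have [p [autp pE]] := limK.2 _ _ _ eBP (embF_comp embg eCP).
exists p; split=> //; exists i => f embf; rewrite pE.
have embgf : emb A C (g \o f).
  case: embg embf => [? gP] [? fP]; split; first exact: inj_comp.
  by move=> R x; rewrite fP gP.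
rewrite -[LHS]/(col (eC \o (g \o f))) (cP _ _ embgf erefl); apply: iP.
  by exists (g \o f).
by rewrite imset_comp imsetS// finset.subsetT.
Qed.

End RamseyLimit.

(** * Fixed points of the stabilizer of the order *)

Lemma compact_finite_nbhs (Y : topologicalType) (Z : set Y) (W : Y -> set Y) :
  compact Z -> (forall y, Z y -> nbhs y (W y)) ->
  exists s : seq Y, forall z, Z z -> exists y, [/\ y \in s, Z y & W y z].
Proof.
move=> /compact_near_coveringP cZ nW.
(* [F] is the filter of sufficiently large finite lists; what holds near [F] holds for some list. *)
pose F : set_system (seq Y) :=
  [set S | exists s0 : seq Y, forall s, {subset s0 <= s} -> S s].
have FF : Filter F.
  split; first by exists [::].
  - move=> A B [s sA] [t tB]; exists (s ++ t) => u stu; split.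
      by apply: sA => y ys; apply: stu; rewrite mem_cat ys.
    by apply: tB => y yt; apply: stu; rewrite mem_cat yt orbT.
  - by move=> A B AB [s sA]; exists s => u /sA/AB.
have [s0 /(_ s0 (fun _ => id)) s0P] :
    \forall s \near F, Z `<=` (fun z => exists y, [/\ y \in s, Z y & W y z]).
  apply: cZ => z Zz; exists (W z, [set s | z \in s]); last first.
    by move=> [w s] /= [Wzw zs]; exists z.
  by split=> /=; [exact: nW|exists [:: z] => s; apply; exact: mem_head].
by exists s0.
Qed.

Section FixedPoint.
Context {sym : Type} {ar : sym -> nat} {T : choiceType}.
Variables (Kstar : fstruc (oar ar) -> Prop) (J : interp (oar ar) T).
Hypotheses (ordK : ordered_class Kstar) (ramK : ramsey Kstar)
  (limK : is_flim Kstar J).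
Variables (Y : topologicalType) (act : (T -> T) -> Y -> Y).
Hypothesis flowY : is_flow (aut J) Y act.

(** Separating [y] from [act h y] gives a neighbourhood [V] of [y] disjoint from its translate;
    continuity of the action at the identity then gives [W] and [A]. *)
Lemma displaced_nbhs h y : aut J h -> act h y <> y ->
  exists (V : set Y) (A : seq T) (W : set Y),
    [/\ nbhs y W, forall v, V v -> ~ V (act h v) &
        forall g w, aut J g -> W w -> (forall a, a \in A -> g a = a) ->
          V (act g w)].
Proof.
case: flowY => _ hY act1 _ cont autH hy.
move: hY; rewrite open_hausdorff => /(_ y (act h y)) [].
  by apply/eqP => /esym.
move=> [P Q] /= [/set_mem Py /set_mem Qhy] [oP oQ /eqP PQ0].
have [A' [V' [nV' V'Q]]] := cont h y Q autH (open_nbhs_nbhs (conj oQ Qhy)).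
pose V := P `&` V'.
have nV : nbhs (act id y) V.
  by rewrite act1; apply: filterI nV'; exact: open_nbhs_nbhs.
have [A [W [nW WV]]] := cont id y V (aut_id J) nV.
exists V, A, W; split=> //.
  move=> v [_ V'v] [Phv _].
  have : (P `&` Q) (act h v) by split=> //; exact: V'Q.
  by rewrite PQ0.
Qed.

(** Were every point of [Z] displaced, finitely many sets [W y] would cover [Z]. Colouring the
    embeddings of a finite set [E] by this cover, the Ramsey property yields one [y] and one point
    that lies in [V y] together with its image under [h y]. *)
Theorem flow_fixed_point (Z : set Y) : closed Z -> Z !=set0 ->
  (forall h z, aut J h -> Z z -> Z (act h z)) ->
  exists z, Z z /\ forall h, aut J h -> act h z = z.
Proof.
case: (flowY) => cY _ _ actM _ clZ [y0 Zy0] invZ.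
apply: contrapT => nfix.
have /choice[d dP] (y : Y) :
    exists d : (T -> T) * set Y * seq T * set Y, Z y ->
      let: (h, V, A, W) := d in
      [/\ aut J h, nbhs y W, forall v, V v -> ~ V (act h v) &
        forall g w, aut J g -> W w -> (forall a, a \in A -> g a = a) ->
          V (act g w)].
  have [Zy|nZy] := pselect (Z y); last by exists (id, set0, [::], set0).
  have [h [autH hy]] : exists h, aut J h /\ act h y <> y.
    apply: contrapT => nh; apply: nfix; exists y; split=> // h autH.
    by apply: contrapT => hy; apply: nh; exists h.
  have [V [A [W [nW VP WP]]]] := displaced_nbhs autH hy.
  by exists (h, V, A, W).
pose h y := (d y).1.1.1; pose V y := (d y).1.1.2.
pose A y := (d y).1.2; pose W y := (d y).2.
have {}dP y : Z y -> [/\ aut J (h y), nbhs y (W y),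
    forall v, V y v -> ~ V y (act (h y) v) &
    forall g w, aut J g -> W y w -> (forall a, a \in A y -> g a = a) ->
      V y (act g w)].
  by move=> /dP; rewrite /h /V /A /W; case: (d y) => [[[]]].
have cZ : compact Z by exact: subclosed_compact clZ cY _.
have [s sP] : exists s : seq Y,
    forall z, Z z -> exists y, [/\ y \in s, Z y & W y z].
  by apply: compact_finite_nbhs => // y /dP[].
pose E := flatten [seq A y | y <- s].
have AE y a : y \in s -> a \in A y -> a \in E.
  by move=> ys aA; apply/flattenP; exists (A y) => //; exact: map_f.
pose eE := seq_enum E; pose SE := induced J eE.
have eEP : embF SE J eE := induced_embF J (@seq_enum_inj _ E).
have KE : Kstar SE by apply/limK.1; exists eE.
(* Both the identity and the inverse of each [h y] map [E] into [B]; these are the two instances of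
   [key] used below. *)
pose B := E ++ flatten [seq map (invf (h y)) E | y <- s].
pose eB := seq_enum B; pose SB := induced J eB.
have eBP : embF SB J eB := induced_embF J (@seq_enum_inj _ B).
(* Large enough to index [s], and at least 2 as the Ramsey property requires. *)
pose k := (size s).+2.
(* The colour of an embedding [e] names a set [W y] containing [g y0] for some
   [g] carrying [e] back to the inclusion of [E]. *)
have /choice[col colP] (e : 'I_(fsz SE) -> T) : exists i : 'I_k, embF SE J e ->
    let y := nth y0 s i in [/\ y \in s, Z y &
      exists g, [/\ aut J g, g \o e = eE & W y (act g y0)]].
  have [eP|ne] := pselect (embF SE J e); last by exists ord0.
  have [g [autg gE]] := limK.2 _ _ _ eP eEP.
  have [y [ys Zy Wy]] := sP _ (invZ _ _ autg Zy0).
  have ik : index y s < k by rewrite ltnS ltnW// ltnS ltnW// index_mem.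
  exists (Ordinal ik) => _ /=; rewrite nth_index//; split=> //.
  by exists g.
have [p [autp [i pP]]] := ramsey_flim ordK ramK limK col KE eBP (erefl : 2 <= k).
pose y := nth y0 s i.
have autpV := aut_inv autp.
(* The embedding [p \o q] of [E] has the common colour, witnessed by some [g] that undoes it on [E].
   Hence the automorphism [v] below fixes [E] pointwise and moves [act g y0], a point of [W y], into
   [V y]. *)
have key q : aut J q -> (forall a, a \in E -> q a \in B) ->
    [/\ y \in s, Z y & V y (act (invf q \o invf p) y0)].
  move=> autq qB; have qP := embF_aut eEP autq.
  have [f [embf fE]] : exists f, emb SE SB f /\ eB \o f = q \o eE.
    apply: (embF_factor qP eBP) => a; apply: seq_enumP; apply: qB.
    exact: mem_seq_enum.
  have := colP _ (embF_aut qP autp).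
  have -> : p \o (q \o eE) = p \o eB \o f by rewrite -fE.
  rewrite pP// => -[ys Zy [g [autg gE Wg]]]; split=> //.
  have [_ _ _ WV] := dP _ Zy.
  pose v := invf q \o invf p \o invf g.
  have autv : aut J v.
    by apply: aut_comp (aut_inv autg); apply: aut_comp => //; exact: aut_inv.
  have -> : invf q \o invf p = v \o g.
    by rewrite /v -[RHS]compA (invf_comp autg).
  rewrite actM//; apply: WV => // a aA.
  have [j ja] := seq_enumP (AE _ _ ys aA).
  have := congr1 (fun u => u j) gE.
  rewrite /= -[eB (f j)]/((eB \o f) j) fE /= /eE ja => ga.
  rewrite -{1}ga /v /= (invfKV (aut_bij autg)) (invfKV (aut_bij autp)).
  exact: invfKV (aut_bij autq) _.
have [|ys Zy Vy] := key id (aut_id J).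
  by move=> a aE; rewrite mem_cat aE.
have [autH _ disj _] := dP _ Zy.
have [] := key (invf (h y)) (aut_inv autH).
  move=> a aE; rewrite mem_cat; apply/orP; right; apply/flattenP.
  by exists (map (invf (h y)) E); exact: map_f.
move=> _ _.
have -> : invf (invf (h y)) = h y.
  by apply: invf_unique; [exact: invfK (aut_bij autH)|exact: invfKV (aut_bij autH)].
rewrite actM//; apply: disj.
by move: Vy; rewrite (@invf_unique _ id id).
Qed.

End FixedPoint.

(** * The flow of admissible orders *)

Section OrderSpace.
Context {sym : Type} {ar : sym -> nat} {T : choiceType}.
Variables (Kstar : fstruc (oar ar) -> Prop) (I : interp ar T).

Definition adm_rel (r : T -> T -> Prop) := forall A e, embF A I e ->
  admissible Kstar A (fun x y => r (e x) (e y)).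

Record order_space := OrderSpace {
  order_rel :> T -> T -> Prop;
  order_relP : adm_rel order_rel }.

Lemma order_space_eq (r r' : order_space) :
  (forall x y, r x y = r' x y) -> r = r'.
Proof.
case: r r' => [r rP] [r' r'P] /= rr'.
have {}rr' : r = r' by apply/funext => x; apply/funext => y; exact: rr'.
by case: _ / rr' r'P => r'P; congr OrderSpace; exact: Prop_irrelevance.
Qed.

Definition agree (s : seq T) (r r' : T -> T -> Prop) :=
  forall x y, x \in s -> y \in s -> r x y = r' x y.

(** The topology induced from the product of two-point discrete spaces indexed by pairs of points of
    [T]. *)
Definition order_nbhs (r : order_space) : set_system order_space :=
  [set U | exists s, forall r' : order_space, agree s r' r -> U r'].

HB.instance Definition _ := gen_eqMixin order_space.
HB.instance Definition _ := gen_choiceMixin order_space.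
HB.instance Definition _ := hasNbhs.Build order_space order_nbhs.

Lemma order_nbhs_filter (r : order_space) : ProperFilter (nbhs r).
Proof.
split; first by case=> s /(_ r); apply.
split; first by exists [::].
- move=> A B [s sA] [t tB]; exists (s ++ t) => r' r'r; split.
    by apply: sA => x y xs ys; apply: r'r; rewrite mem_cat ?xs ?ys.
  by apply: tB => x y xt yt; apply: r'r; rewrite mem_cat ?xt ?yt orbT.
- by move=> A B AB [s sA]; exists s => r' /sA/AB.
Qed.

Lemma order_nbhs_singleton (r : order_space) (U : set order_space) :
  nbhs r U -> U r.
Proof. by case=> s; apply. Qed.

Lemma order_nbhs_nbhs (r : order_space) (U : set order_space) :
  nbhs r U -> nbhs r (nbhs^~ U).
Proof.
case=> s sU; exists s => r' r'r; exists s => r'' r''r'; apply: sU => x y xs ys.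
by rewrite r''r'// r'r.
Qed.

HB.instance Definition _ := Nbhs_isNbhsTopological.Build order_space
  order_nbhs_filter order_nbhs_singleton order_nbhs_nbhs.

(** Admissibility is tested on one finite structure at a time, so it passes to pointwise limits. *)
Lemma adm_rel_agree r : (forall s, exists r' : order_space, agree s r' r) ->
  adm_rel r.
Proof.
move=> rP A e eP; have [r' r'r] := rP [seq e i | i <- enum 'I_(fsz A)].
have -> : (fun x y => r (e x) (e y)) = (fun x y => r' (e x) (e y)).
  apply/funext => x; apply/funext => y.
  by rewrite r'r//; apply/map_f; rewrite mem_enum.
exact: order_relP.
Qed.

Lemma order_space_compact : compact [set: order_space].
Proof.
rewrite compact_ultra => F FU _.
(* The limit of the ultrafilter is decided pair by pair, by majority with respect to [F]. *)
pose r x y := F [set r' : order_space | r' x y].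
have rP (l : seq (T * T)) : F [set r' : order_space |
    forall p, p \in l -> r' p.1 p.2 = r p.1 p.2].
  elim: l => [|[x y] l IHl]; first by apply: filterS filterT.
  suff xyP : F [set r' : order_space | r' x y = r x y].
    apply: filterS (filterI xyP IHl) => r' [r'xy r'l] p.
    by rewrite inE => /orP[/eqP ->//|/r'l].
  have [Fxy|Fxy] := in_ultra_setVsetC [set r' : order_space | r' x y] FU.
    by apply: filterS (Fxy) => r' r'xy; apply/propext.
  apply: filterS (Fxy) => r' r'xy; apply/propext; split=> // rxy.
  by have [r'' []] := filter_ex (filterI rxy Fxy).
have agrP s : F [set r' : order_space | agree s r' r].
  apply: filterS (rP [seq (x, y) | x <- s, y <- s]) => r' r's x y xs ys.
  by rewrite -(r's (x, y))//; apply/allpairsP; exists (x, y).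
have r_adm : adm_rel r.
  by apply: adm_rel_agree => s; have [r' ?] := filter_ex (agrP s); exists r'.
exists (OrderSpace r_adm); split=> // U [s sU].
by apply: filterS (agrP s) => r'; exact: sU.
Qed.

Lemma order_space_hausdorff : hausdorff_space order_space.
Proof.
move=> p q pq; apply: order_space_eq => x y.
pose N (r : order_space) := [set r' : order_space | agree [:: x; y] r' r].
have nN r : nbhs r (N r) by exists [:: x; y].
have [r [rp rq]] := pq _ _ (nN p) (nN q).
by rewrite -(rp x y) -?(rq x y)// !inE eqxx ?orbT.
Qed.

Lemma adm_rel_act g (r : order_space) : aut I g ->
  adm_rel (fun x y => r (invf g x) (invf g y)).
Proof. by move=> /aut_inv autg A e eP; exact: order_relP (embF_aut eP autg). Qed.

(** A flow acts by all maps [T -> T]; those that are not automorphisms act trivially by default. *)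
Definition order_act (g : T -> T) (r : order_space) : order_space :=
  if pselect (aut I g) is left autg then OrderSpace (adm_rel_act r autg) else r.

Lemma order_actE g (r : order_space) x y : aut I g ->
  order_act g r x y = r (invf g x) (invf g y).
Proof. by rewrite /order_act; case: pselect. Qed.

Lemma order_act_id r : order_act id r = r.
Proof.
apply: order_space_eq => x y.
by rewrite order_actE ?(@invf_unique _ id id)//; exact: aut_id.
Qed.

Lemma order_act_comp g h r : aut I g -> aut I h ->
  order_act (g \o h) r = order_act g (order_act h r).
Proof.
move=> autg auth; apply: order_space_eq => x y.
rewrite !order_actE//; last exact: aut_comp.
have [bg bh] := (aut_bij autg, aut_bij auth).
rewrite (@invf_unique _ _ (invf h \o invf g))// => z /=.
  by rewrite !invfKV.
by rewrite !invfK.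
Qed.

Lemma order_actK g : aut I g -> cancel (order_act g) (order_act (invf g)).
Proof.
move=> autg r; rewrite -order_act_comp ?(invf_comp autg) ?order_act_id//.
exact: aut_inv.
Qed.

Lemma order_flow : is_flow (aut I) order_space order_act.
Proof.
split; [exact: order_space_compact|exact: order_space_hausdorff|
  exact: order_act_id|by move=> *; exact: order_act_comp|].
move=> g r U autg [s sU].
have bg := aut_bij autg.
(* The translate by [g] reads on [s] what the order is on the preimage of [s], and any [h] agreeing
   with [g] on [A] has the same preimages of [s]. *)
pose A := [seq invf g x | x <- s].
exists A, [set r' : order_space | agree A r' r].
split; first by exists A.
move=> h r' auth r'r hg; apply: sU => x y xs ys; rewrite !order_actE//.
have hgV z : z \in s -> invf h z = invf g z.
  move=> zs; apply: (bij_inj (aut_bij auth)).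
  by rewrite (invfK (aut_bij auth)) hg ?map_f// invfK.
by rewrite !hgV// r'r//; apply: map_f.
Qed.

End OrderSpace.

(** * The orbit of the generic order and minimality *)

Section OrderFlow.
Context {sym : Type} {ar : sym -> nat} {T : choiceType}.
Variables (K : fstruc ar -> Prop) (Kstar : fstruc (oar ar) -> Prop).
Variables (I : interp ar T) (ltstar : T -> T -> Prop).
Let J := expandI I ltstar.
Hypotheses (limK : is_flim K I) (limKs : is_flim Kstar J).

Lemma expandI_embF A lt e : embF (expand A lt) J e <->
  embF A I e /\ forall x y, lt x y <-> ltstar (e x) (e y).
Proof.
split=> [[inje eP]|[[inje eP] ltP]].
  split; first by split=> // R; exact: (eP (Some R)).
  by move=> x y; exact: (eP None (pair2 x y)).
by split=> // -[R|] x; [exact: eP|exact: ltP].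
Qed.

Lemma expandI_aut g : aut J g <->
  aut I g /\ forall x y, ltstar x y <-> ltstar (g x) (g y).
Proof.
split=> [[bg gP]|[[bg gP] ltP]].
  split; first by split=> // R; exact: (gP (Some R)).
  by move=> x y; exact: (gP None (pair2 x y)).
by split=> // -[R|] x; [exact: gP|exact: ltP].
Qed.

Lemma ltstar_adm : adm_rel Kstar I ltstar.
Proof. by move=> A e eP; apply/limKs.1; exists e; apply/expandI_embF. Qed.

Definition star_order : order_space Kstar I := OrderSpace ltstar_adm.

Local Notation "g *: r" := (order_act g r).

(** With [star_order_stab], this identifies the orbit of [star_order] with the left cosets of
    [aut J]. *)
Lemma star_order_orbit g k : aut I g -> aut I k ->
  g *: star_order = k *: star_order -> aut J (invf k \o g).
Proof.
move=> autg autk /(congr1 (fun r : order_space _ _ => order_rel r)) gk.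
apply/expandI_aut; split; first exact: aut_comp (aut_inv autk) autg.
move=> x y; have := congr1 (fun r => r (g x) (g y)) gk.
by rewrite !order_actE// !(invfKV (aut_bij autg)) /= => ->.
Qed.

Lemma star_order_stab h : aut J h -> h *: star_order = star_order.
Proof.
move=> /[dup] autJ /expandI_aut[auth hP]; apply: order_space_eq => x y.
rewrite order_actE//=; apply/propext; rewrite hP.
by rewrite !(invfK (aut_bij auth)).
Qed.

(** The order [r] on [s] gives a member of [Kstar], which occurs in the ordered limit; homogeneity
    of the reduct moves that occurrence onto [s]. *)
Lemma star_order_dense (r : order_space Kstar I) (s : seq T) :
  exists g, aut I g /\ agree s (g *: star_order) r.
Proof.
pose e := seq_enum s; pose A := induced I e.
have eP : embF A I e := induced_embF I (@seq_enum_inj _ s).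
have [e' /expandI_embF[e'P lte']] := (limKs.1 _).1 (order_relP r eP).
have [g [autg ge]] := limK.2 _ _ _ e'P eP.
exists g; split=> // x y /seq_enumP[i <-] /seq_enumP[j <-].
rewrite order_actE//.
have inv_e a : invf g (seq_enum s a) = e' a.
  by rewrite -[seq_enum s]ge /= (invfKV (aut_bij autg)).
by rewrite !inv_e; apply/propext; rewrite /= -lte'.
Qed.

Hypothesis opK : ordering_property K Kstar.

(** The ordering property provides a [B] on whose copy the order [r], whatever it is, contains the
    generic order of [s]; homogeneity moves this piece onto [s]. *)
Lemma star_order_in_closure (r : order_space Kstar I) (s : seq T) :
  exists g, aut I g /\ agree s (g *: r) star_order.
Proof.
pose e := seq_enum s; pose A := induced I e.
have eP : embF A I e := induced_embF I (@seq_enum_inj _ s).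
have KA : K A by apply/limK.1; exists e.
have [B [KB BP]] := opK KA.
have [eB eBP] := (limK.1 B).1 KB.
have [f [injf fP]] := BP _ _ (order_relP star_order eP) (order_relP r eBP).
have embf : emb A B f by split=> // R; exact: (fP (Some R)).
have [g [autg ge]] := limK.2 _ _ _ (embF_comp embf eBP) eP.
exists g; split=> // x y /seq_enumP[i <-] /seq_enumP[j <-].
rewrite order_actE//.
have inv_e a : invf g (seq_enum s a) = eB (f a).
  by rewrite -[seq_enum s]ge /= (invfKV (aut_bij autg)).
rewrite !inv_e; apply/propext.
by have := fP None (pair2 i j); rewrite /= => <-.
Qed.

Lemma order_flow_minimal : minimal_flow (aut I) (order_space Kstar I)
  (@order_act _ _ _ Kstar I).
Proof.
split; [exact: order_flow|by exists star_order|].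
move=> Z clZ [r Zr] invZ.
have Zstar : Z star_order.
  apply: clZ => U [s sU]; have [g [autg gs]] := star_order_in_closure r s.
  by exists (g *: r); split; [exact: invZ|exact: sU].
apply/seteqP; split=> // r' _; apply: clZ => U [s sU].
have [g [autg gs]] := star_order_dense r' s.
by exists (g *: star_order); split; [exact: invZ|exact: sU].
Qed.

End OrderFlow.

(** * The index of the stabilizer *)

(** The fibres of [sigma] on [G] are the left cosets of [H], so one representative is chosen per
    value. *)
Lemma index_eq_card (T : Type) (G H : (T -> T) -> Prop) (V : finType)
    (sigma : (T -> T) -> V) :
  (forall g k, G g -> G k ->
    sigma g = sigma k <-> exists h, H h /\ g = k \o h) ->
  index_eq G H #|[set v | `[< exists g, G g /\ sigma g = v >]]%SET|.
Proof.
move=> sP; set S := [set v | _]%SET.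
have /choice[r rP] (i : 'I_#|S|) : exists g, G g /\ sigma g = enum_val i.
  by have := enum_valP i; rewrite !inE.
exists r; split; first by move=> i; have [] := rP i.
split=> [g Gg|i j h Hh rij].
  have gS : sigma g \in S by rewrite !inE; exists g.
  have [Gr rE] := rP (enum_rank_in gS (sigma g)).
  exists (enum_rank_in gS (sigma g)); apply/sP => //.
  by rewrite rE enum_rankK_in.
have [[Gi iE] [Gj jE]] := (rP i, rP j).
by apply: enum_val_inj; rewrite -iE -jE; apply/sP => //; exists h.
Qed.

Section Index.
Context {sym : Type} {ar : sym -> nat} {T : choiceType}.
Variables (K : fstruc ar -> Prop) (Kstar : fstruc (oar ar) -> Prop).
Variables (I : interp ar T) (ltstar : T -> T -> Prop).
Let J := expandI I ltstar.
Hypotheses (limK : is_flim K I) (limKs : is_flim Kstar J).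
Hypotheses (ordK : ordered_class Kstar).

(** Each axiom concerns at most three points, and these span a member of [Kstar]. *)
Lemma ltstar_linear : strict_linear_order ltstar.
Proof.
have lin s : strict_linear_order
    (fun i j => ltstar (seq_enum s i) (seq_enum s j)).
  apply: (ordK (B := induced J (seq_enum s))); apply/limKs.1.
  by exists (seq_enum s); apply: induced_embF; exact: seq_enum_inj.
have sE (s : seq T) x : x \in s -> exists i, seq_enum s i = x by exact: seq_enumP.
split; [|split].
- move=> a; have [i <-] := sE [:: a] a (mem_head _ _).
  by have [irr _] := lin [:: a]; exact: irr.
- move=> a b c.
  have [] : [/\ exists i, seq_enum [:: a; b; c] i = a,
      exists i, seq_enum [:: a; b; c] i = b &
      exists i, seq_enum [:: a; b; c] i = c].
    by split; apply: sE; rewrite !inE eqxx ?orbT.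
  have [_ [trans _]] := lin [:: a; b; c].
  by move: trans => /[swap] -[i ia] /[swap] -[j jb] /[swap] -[l lc];
    move=> /(_ i j l); rewrite ia jb lc.
- move=> a b ab.
  have [i ia] : exists i, seq_enum [:: a; b] i = a.
    by apply: sE; rewrite !inE eqxx.
  have [j jb] : exists i, seq_enum [:: a; b] i = b.
    by apply: sE; rewrite !inE eqxx orbT.
  have [_ [_ /(_ i j)]] := lin [:: a; b]; rewrite ia jb; apply=> ij.
  by apply: ab; rewrite -[LHS]ia -[RHS]jb ij.
Qed.

(** On the pair, [g] is an embedding for the ordered structure as well, so homogeneity of the
    ordered limit extends it. *)
Lemma pair_homogeneous g a b : aut I g ->
  (ltstar a b <-> ltstar (g a) (g b)) ->
  exists h, [/\ aut J h, h a = g a & h b = g b].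
Proof.
move=> autg gab; pose s := [:: a; b]; pose e := seq_enum s.
have [irr [trans tot]] := ltstar_linear.
have tri x y : [\/ x = y, ltstar x y | ltstar y x].
  have [xy|/tot[xy|yx]] := pselect (x = y);
    [exact: Or31|exact: Or32|exact: Or33].
have injg := bij_inj (aut_bij autg).
pose A := expand (induced I e) (fun i j => ltstar (e i) (e j)).
have eP : embF (induced I e) I e := induced_embF I (@seq_enum_inj _ s).
have eJ : embF A J e by apply/expandI_embF.
have geJ : embF A J (g \o e).
  apply/expandI_embF; split; first exact: embF_aut.
  have flip : ltstar b a <-> ltstar (g b) (g a).
    split=> [ba|gba].
      have [/injg ab|gab'|//] := tri (g a) (g b).
      + by case: (irr b); rewrite -{2}ab.
      + by case: (irr a); apply: trans ba; apply/gab.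
    have [ab|ab|//] := tri a b.
    - by case: (irr (g b)); rewrite -{2}ab.
    - by case: (irr (g a)); apply: trans gba; apply/gab.
  move=> i j; have := mem_seq_enum i; have := mem_seq_enum j.
  rewrite /s !inE => /orP[]/eqP + /orP[]/eqP; rewrite -/e /= => -> -> //.
  - by split=> /irr.
  - by split=> /irr.
have [h [auth he]] := limKs.2 _ _ _ eJ geJ; exists h; split=> //.
- have [i <-] : exists i, e i = a by apply: seq_enumP; rewrite mem_head.
  exact: (congr1 (fun u => u i) he).
- have [i <-] : exists i, e i = b.
    by apply: seq_enumP; rewrite !inE eqxx orbT.
  exact: (congr1 (fun u => u i) he).
Qed.

(** * Signs of automorphisms when the stabilizer is normal *)

Section Normal.
Hypothesis nJ : normal_sub (aut I) (aut J).

(** Some [h] in [aut J] agrees with [k] on the pair; its conjugate by [g] preserves the order and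
    sends [g a], [g b] to [g (k a)], [g (k b)]. *)
Lemma normal_pair_imply g k a b : aut I g -> aut I k ->
  (ltstar a b <-> ltstar (k a) (k b)) ->
  (ltstar (g a) (g b) <-> ltstar (g (k a)) (g (k b))).
Proof.
move=> autg autk /(pair_homogeneous autk)[h [auth <- <-]].
have [gK Kg] := (invfKV (aut_bij autg), invfK (aut_bij autg)).
have /expandI_aut[_ /(_ (g a) (g b))] := nJ autg gK Kg auth.
by rewrite /= !gK.
Qed.

Definition lt_sign a b : bool := `[< ltstar a b >].

(* An [aut I]-orbit of pairs splits into at most two [aut J]-orbits, told apart
   by [ltstar]; since [aut J] is normal, [g] permutes these. *)
Lemma normal_pair_sign g k a b : aut I g -> aut I k ->
  lt_sign (g (k a)) (g (k b)) (+) lt_sign (k a) (k b) =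
  lt_sign (g a) (g b) (+) lt_sign a b.
Proof.
move=> autg autk.
have asE x y x' y' :
    (lt_sign x y = lt_sign x' y') <-> (ltstar x y <-> ltstar x' y').
  by split=> xy; [exact: asbool_eq_equiv|exact: asbool_equiv_eq].
have fwd := normal_pair_imply autg autk.
(* The converse is the same implication for the inverse of [g] and the conjugate of [k] by [g]. *)
have bwd : (ltstar (g a) (g b) <-> ltstar (g (k a)) (g (k b))) ->
    (ltstar a b <-> ltstar (k a) (k b)).
  have [gK Kg] := (invfKV (aut_bij autg), invfK (aut_bij autg)).
  have autc : aut I (g \o k \o invf g).
    exact: aut_comp (aut_comp autg autk) (aut_inv autg).
  have := normal_pair_imply (a := g a) (b := g b) (aut_inv autg) autc.
  by rewrite /= !gK.
have : (lt_sign a b = lt_sign (k a) (k b)) <->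
    (lt_sign (g a) (g b) = lt_sign (g (k a)) (g (k b))).
  by split=> /asE ab; apply/asE; [exact: fwd|exact: bwd].
(* Two equalities between booleans are equivalent exactly when the four booleans sum to zero modulo
   2. *)
move: (lt_sign (g (k a)) _) (lt_sign (g a) _) (lt_sign (k a) _) (lt_sign a b).
by move=> [] [] [] [] [p q] //;
  first [by have := p erefl | by have := q erefl].
Qed.

Variables (n : nat) (u : 'I_n -> 'I_2 -> T).
Hypothesis uP : forall x : 'I_2 -> T, exists i g, aut I g /\ g \o u i = x.

Definition pair_sign (g : T -> T) i : bool :=
  let a := u i ord0 in let b := u i ord_max in
  lt_sign (g a) (g b) (+) lt_sign a b.

(** Taking values in a vector space over ['F_2] makes [sign_row] a homomorphism on [aut I] with
    kernel [aut J]. *)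
Definition sign_row (g : T -> T) : 'rV['F_2]_n :=
  \row_i (pair_sign g i : nat)%:R%R.

Lemma natr_F2_addb (b c : bool) :
  ((b (+) c : nat)%:R = (b : nat)%:R + (c : nat)%:R :> 'F_2)%R.
Proof. by apply/eqP; case: b; case: c. Qed.

Lemma sign_row_comp g k : aut I g -> aut I k ->
  sign_row (g \o k) = (sign_row g + sign_row k)%R.
Proof.
move=> autg autk; apply/rowP => i; rewrite !mxE -natr_F2_addb.
rewrite /pair_sign -(normal_pair_sign (u i ord0) (u i ord_max) autg autk) /=.
by rewrite -addbA; congr (_%:R)%R; congr (nat_of_bool (_ (+) _)); rewrite addKb.
Qed.

Lemma sign_row0P g : aut I g -> sign_row g = 0%R <-> aut J g.
Proof.
move=> autg; split=> [g0|/expandI_aut[_ gP]]; last first.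
  apply/rowP => i; rewrite !mxE /pair_sign /lt_sign.
  by rewrite -(asbool_equiv_eq (gP _ _)) addbb.
apply/expandI_aut; split=> // x y.
have [i [k [autk kE]]] := uP (pair2 x y).
have kx : k (u i ord0) = x := congr1 (fun v => v ord0) kE.
have ky : k (u i ord_max) = y := congr1 (fun v => v ord_max) kE.
have /rowP/(_ i) := g0; rewrite !mxE.
have := normal_pair_sign (u i ord0) (u i ord_max) autg autk.
rewrite kx ky -[RHS]/(pair_sign g i); case: pair_sign => // sE _.
apply: asbool_eq_equiv; apply/esym/eqP; rewrite -negb_add.
by move: sE; rewrite /lt_sign => ->.
Qed.

Lemma normal_index_pow2 : exists m, index_eq (aut I) (aut J) (2 ^ m).
Proof.
have sP g k : aut I g -> aut I k ->
    sign_row g = sign_row k <-> exists h, aut J h /\ g = k \o h.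
  move=> autg autk; split=> [gk|[h [auth ->]]]; last first.
    have [autIh _] := (expandI_aut _ _ _).1 auth.
    by rewrite sign_row_comp// (sign_row0P autIh).2// GRing.addr0.
  have autkg := aut_comp (aut_inv autk) autg.
  have gE : g = k \o (invf k \o g) by rewrite compA (comp_invf autk).
  exists (invf k \o g); split=> //; apply/sign_row0P => //.
  by apply: (GRing.addrI (sign_row k)); rewrite -sign_row_comp// -gE GRing.addr0.
have := index_eq_card sP; set S := [set v | _]%SET.
(* The group law on row vectors is addition, so the image [S] is a subgroup and Lagrange's theorem
   bounds its order by divisibility. *)
have gS : group_set S.
  apply/group_setP; split.
    rewrite !inE; exists id; split; first exact: aut_id.
    by apply/sign_row0P; exact: aut_id.
  move=> v w; rewrite !inE => -[g [autg <-]] [k [autk <-]].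
  exists (g \o k); split; first exact: aut_comp.
  exact: sign_row_comp.
have : #|S| %| 2 ^ n.
  have := @cardSg _ [set: 'rV['F_2]_n]%G (Group gS) (finset.subsetT _).
  by rewrite cardsT card_mx card_Fp// mul1n.
by move=> /dvdn_pfactor-/(_ isT)[m _ ->] ?; exists m.
Qed.

End Normal.

Hypotheses (ramK : ramsey Kstar) (opK : ordering_property K Kstar).

Local Notation X := (order_space Kstar I).
Local Notation star := (star_order limKs).

Lemma flow_restrict (Y : topologicalType) act :
  is_flow (aut I) Y act -> is_flow (aut J) Y act.
Proof.
have sub g : aut J g -> aut I g by move=> /expandI_aut[].
move=> [cY hY act1 actM cont]; split=> //.
  by move=> g h x /sub ? /sub ?; exact: actM.
move=> g x U /sub autg nU; have [A [V [nV VP]]] := cont g x U autg nU.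
by exists A, V; split=> // h y /sub; exact: VP.
Qed.

(** * Consequences of finite index *)

Section FiniteIndex.
Variables (n : nat) (r : 'I_n -> T -> T).
Hypotheses (autr : forall i, aut I (r i))
  (rP : forall g, aut I g -> exists i h, aut J h /\ g = r i \o h)
  (rinj : forall i j h, aut J h -> r i = r j \o h -> i = j).

Lemma orbit_rep g : aut I g -> exists i, order_act g star = order_act (r i) star.
Proof.
move=> /rP[i [h [auth ->]]]; exists i.
rewrite order_act_comp ?(star_order_stab _ auth)//.
by case/expandI_aut: auth.
Qed.

(** The orbit of [star] is finite, and finite subsets of a Hausdorff space are closed. *)
Lemma orbit_subset_closed (Z : set X) :
  (forall z, Z z -> exists g, aut I g /\ z = order_act g star) -> closed Z.
Proof.
move=> ZP.
apply: (accessible_finite_set_closed.1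
  (hausdorff_accessible (@order_space_hausdorff _ _ _ _ _))).
apply: (@sub_finite_set _ _ [set order_act (r i) star | i in [set: 'I_n]]).
  by move=> z /ZP[g [/orbit_rep[i ->] ->]]; exists i.
by apply: finite_image; exact: finite_finset.
Qed.

Lemma finite_index_normal : normal_sub (aut I) (aut J).
Proof.
move=> g ginv h autg gK Kg auth.
have sub k : aut J k -> aut I k by move=> /expandI_aut[].
have <- : invf g = ginv by exact: invf_unique.
have autgV := aut_inv autg; have autIh := sub _ auth.
(* An element [h] fixes [z0] exactly when its conjugate by [g] fixes [star]. *)
pose z0 := order_act (invf g) star.
pose Z := [set z | exists k, aut J k /\ z = order_act k z0].
have [|||z [[k [autk ->]] zfix]] :=
    flow_fixed_point ordK ramK limKs (flow_restrict (order_flow Kstar I)) (Z := Z).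
- apply: orbit_subset_closed => z [k [/sub autk ->]].
  exists (k \o invf g); rewrite order_act_comp//; split=> //.
  exact: aut_comp.
- by exists (order_act id z0), id; split=> //; exact: aut_id.
- move=> k z autk [l [autl ->]]; exists (k \o l).
  rewrite order_act_comp; [|exact: sub..].
  by split=> //; exact: aut_comp.
have autIk := sub _ autk.
(* The fixed point is the translate of [z0] by [k]; being fixed by the conjugate of [h] by [k], it
   forces [h] to fix [z0]. *)
have hz0 : order_act h z0 = z0.
  have khk : aut J (k \o h \o invf k).
    by apply: aut_comp (aut_inv autk); exact: aut_comp.
  have := zfix _ khk.
  rewrite -order_act_comp//; last exact: sub.
  rewrite -[_ \o k]compA (invf_comp autk) -[_ \o id]/(k \o h) order_act_comp//.
  by move=> /(can_inj (order_actK autIk)).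
move: hz0; rewrite /z0 -order_act_comp//.
move=> /(star_order_orbit (aut_comp autIh autgV) autgV).
by rewrite (@invf_unique _ (invf g) g)//; [exact: invfK (aut_bij autg)|
  exact: invfKV (aut_bij autg)].
Qed.

Lemma finite_index_UMF : UMF_card (aut I) n.
Proof.
have sub k : aut J k -> aut I k by move=> /expandI_aut[].
have minX := order_flow_minimal limK limKs opK.
exists X, (@order_act _ _ _ Kstar I).
(* The finite orbit is closed and invariant, hence all of [X] by minimality. *)
have surj (x : X) : exists i, order_act (r i) star = x.
  pose Z := [set x | exists i, order_act (r i) star = x].
  rewrite -[exists _, _]/(Z x); case: minX => _ _ /(_ Z) ->//.
  - by apply: orbit_subset_closed => _ [i <-]; exists (r i).
  - have [i iE] := orbit_rep (aut_id I).
    by exists (order_act (r i) star), i.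
  - move=> g _ autg [i <-].
    have [j jE] := orbit_rep (aut_comp autg (autr i)).
    by exists j; rewrite -jE order_act_comp.
have [f fP] := choice surj.
have finj i j : order_act (r i) star = order_act (r j) star -> i = j.
  move=> /(star_order_orbit (autr i) (autr j)) autij.
  by apply: (rinj autij); rewrite compA (comp_invf (autr j)).
have fK i : f (order_act (r i) star) = i by apply: finj; rewrite fP.
split; last by exists f; exists (fun i => order_act (r i) star).
split=> // Y actY minY; have [flowY Y0 Ymin] := minY.
have [z [_ zfix]] : exists z : Y, [set: Y] z /\
    forall h, aut J h -> actY h z = z.
  by apply: (flow_fixed_point ordK ramK limKs (flow_restrict flowY));
    [exact: closedT|exact: Y0|].
have [_ hY _ actM _] := flowY.
(* This sends the translate of [star] by [g] to that of [z], independently of the coset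
   representative because [aut J] fixes [z]. *)
pose phi x := actY (r (f x)) z.
have phi_act g x : aut I g -> phi (order_act g x) = actY g (phi x).
  move=> autg; rewrite /phi -[in order_act g x](fP x) -order_act_comp//.
  have autgr := aut_comp autg (autr (f x)).
  have [i [h [auth gE]]] := rP autgr.
  rewrite {1}gE order_act_comp//; last exact: sub.
  rewrite (star_order_stab _ auth) fK -actM// gE.
  by rewrite (actM (r i) h) ?(zfix _ auth)//; exact: sub.
exists phi; split; first split=> //.
  apply/continuousP => A _; rewrite -[_ @^-1` _]setCK; apply: closed_openC.
  by apply: orbit_subset_closed => x _; exists (r (f x)); rewrite fP.
move=> y; suff /seteqP[_ /(_ y Logic.I)[x _ <-]] : phi @` [set: X] = [set: Y].
  by exists x.
apply: Ymin.
- apply: (accessible_finite_set_closed.1 (hausdorff_accessible hY)).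
  apply: (@sub_finite_set _ _ [set actY (r i) z | i in [set: 'I_n]]).
    by move=> _ [x _ <-]; exists (f x).
  by apply: finite_image; exact: finite_finset.
- by exists (phi star), star.
- by move=> g _ autg [x _ <-]; exists (order_act g x) => //; exact: phi_act.
Qed.

End FiniteIndex.

(** A set-theoretic section [s] of the surjection from M(G) to the order space is injective, so
    cosets can be labelled by points of M(G). *)
Lemma UMF_finite_index : UMF_finite (aut I) -> finite_index (aut I) (aut J).
Proof.
move=> [n [Y [actY [[minY univ] [f [f' fK f'K]]]]]].
have [phi [_ /choice[s sP]]] := univ _ _ (order_flow_minimal limK limKs opK).
pose sigma g := f (s (order_act g star)).
exists #|[set v | `[< exists g, aut I g /\ sigma g = v >]]%SET|.
apply: index_eq_card => g k autg autk; split=> [/(can_inj fK) gk|[h [auth ->]]].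
  exists (invf k \o g); split; last by rewrite compA (comp_invf autk).
  by apply: (star_order_orbit (limKs := limKs)) => //; rewrite -[LHS]sP gk sP.
rewrite /sigma order_act_comp//; last by case/expandI_aut: auth.
by rewrite star_order_stab.
Qed.

End Index.

(** * The equivalences *)

Theorem mainTheorem19 (sym : countType) (ar : sym -> nat)
  (K : fstruc ar -> Prop) (Kstar : fstruc (oar ar) -> Prop)
  (T : countType) (I : interp ar T) (ltstar : T -> T -> Prop) :
  fraisse_class K -> companion K Kstar ->
  is_flim K I -> is_flim Kstar (expandI I ltstar) ->
  oligomorphic (aut I) ->
  let GK := aut I in
  let GKstar := aut (expandI I ltstar) in
  (finite_index GK GKstar <-> exists m, index_eq GK GKstar (2 ^ m)) /\
  ((exists m, index_eq GK GKstar (2 ^ m)) <-> UMF_finite GK) /\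
  (UMF_finite GK <-> exists m, UMF_card GK (2 ^ m)) /\
  ((exists m, UMF_card GK (2 ^ m)) <-> normal_sub GK GKstar).
Proof.
move=> _ [ordK [_ [_ [ramK [opK _]]]]] limK limKs oligo GK GKstar.
have normal : finite_index GK GKstar -> normal_sub GK GKstar.
  by move=> [n [r [autr [rP _]]]]; exact: (finite_index_normal limKs ordK ramK autr rP).
have pow2 : normal_sub GK GKstar -> exists m, index_eq GK GKstar (2 ^ m).
  (* Signs are attached to orbits of pairs, hence the exponent 2. *)
  have [n [u uP]] := oligo 2.
  by move=> nJ; exact: (normal_index_pow2 limKs ordK nJ uP).
have umf m : index_eq GK GKstar (2 ^ m) -> UMF_card GK (2 ^ m).
  move=> [r [autr [rP rinj]]].
  exact: (finite_index_UMF limK limKs ordK ramK opK autr rP rinj).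
have fin : UMF_finite GK -> finite_index GK GKstar.
  exact: UMF_finite_index limK limKs opK.
split; [split|split; [split|split; [split|split]]].
- by move=> /normal/pow2.
- by move=> [m mP]; exists (2 ^ m).
- by move=> [m /umf mP]; exists (2 ^ m).
- by move=> /fin/normal/pow2.
- by move=> /fin/normal/pow2[m /umf]; exists m.
- by move=> [m mP]; exists (2 ^ m).
- by move=> [m mP]; apply/normal/fin; exists (2 ^ m).
- by move=> /pow2[m /umf]; exists m.
Qed.
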